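(* Let $u:\mathbb{R}\to\mathbb{R}$ be continuous, bounded and periodic with period $T>0$, let $\Delta t>0$ and $y_{\mathrm{tar}}(t)=u(t+\Delta t)$. Let $\alpha$, $\Omega=\frac1T\bigl(2\pi-\alpha\int_0^Tu(s)\,ds\bigr)>0$, $c_n$ and $w_n$ be as specified in the context, so that the output $$y(t)=\sum_{n=-\infty}^{\infty}w_nc_n\exp\Bigl[in\Bigl(\Omega t+\alpha\int_0^tu(s)\,ds\Bigr)\Bigr]$$ satisfies $\|y-y_{\mathrm{tar}}\|_{L^2(0,T)}=0$. Let $T_{\mathrm{tr}}\ge T$ and define the new input $\overline u$ and new output $\overline y$ (autonomous run) by $$\overline y(t)=\sum_{n=-\infty}^{\infty}w_nc_n\exp\Bigl[in\Bigl(\Omega t+\alpha\int_0^t\overline u(s)\,ds\Bigr)\Bigr],\qquad \overline u(t)=\begin{cases}u(t),&0<t<T_{\mathrm{tr}},\\ \overline y(t-\Delta t),&t>T_{\mathrm{tr}}.\end{cases}$$ Then for every $k\in\mathbb{N}$, $y(t)=\overline y(t)$ on the bounded interval $(0,kT)$ and $\|\overline y-y_{\mathrm{tar}}\|_{L^2(0,kT)}=0$.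
   Context: Kuramoto constants $c_n$: let $\tilde g$ be a probability density on $\mathbb{R}$ of mean $0$ that is either uniform on a symmetric interval, or even, unimodal ($\tilde g$ strictly increasing on $(-\infty,0]$ and strictly decreasing on $[0,\infty)$), $C^2$ and with $\tilde g''(0)<0$; let $K_c=2/(\pi\tilde g(0))$ and $K>K_c$. Let $$\rho_*(\theta,\omega)=\begin{cases}\delta\bigl(\theta-\arcsin\frac{\omega}{Kr_*}\bigr),&|\omega|<Kr_*,\\[4pt]\dfrac{1}{2\pi}\dfrac{\sqrt{\omega^2-K^2r_*^2}}{|\omega-Kr_*\sin\theta|},&|\omega|>Kr_*,\end{cases}$$ with $\delta$ the Dirac delta and $r_*>0$ satisfying $r_*=\int_{\mathbb{R}}\int_0^{2\pi}e^{i\theta}\rho_*\,\tilde g\,d\theta\,d\omega$, be the non-trivial steady state of the Kuramoto system $\partial_t\rho+\partial_\theta(\rho v)=0$, $v=\omega+K|r|\sin(\psi-\theta)$, $r=|r|e^{i\psi}=\int\int e^{i\theta}\rho\,\tilde g\,d\theta\,d\omega$. Put $c_n:=\int_{\mathbb{R}}\int_0^{2\pi}e^{in\theta}\rho_*(\theta,\omega)\tilde g(\omega)\,d\theta\,d\omega\in\mathbb{R}$. The reservoir is the Kuramoto system with input, $v=\alpha u(t)+\omega+K|r|\sin(\psi-\theta)$, and frequency density $g(\omega)=\tilde g(\omega-\Omega)$ of mean $\Omega$; its solution $\rho_*\bigl(\theta-\Omega t-\alpha\int_0^tu\,ds,\ \omega-\Omega\bigr)$ has order parameters $r_n(\alpha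 u;t)=c_ne^{in(\Omega t+\alpha\int_0^tu(s)ds)}$. It is assumed that $|\alpha|$ is sufficiently small and $K>K_c$ is sufficiently close to $K_c$ that all $c_n\neq0$ and $\{r_n(\alpha u;t)\}_{n\in\mathbb{Z}}$ is a complete basis of $L^2(0,T)$. The readout coefficients $\{w_n\}_{n\in\mathbb{Z}}$ are the Fourier coefficients of a real-valued $W_{\mathrm{out}}(\theta)=\sum_nw_ne^{in\theta}\in L^2(0,2\pi)$ and are fixed so that $\|y-y_{\mathrm{tar}}\|_{L^2(0,T)}=0$. The number $T_{\mathrm{tr}}$ is the training time; for $t>T_{\mathrm{tr}}$ the output is fed back, with delay $\Delta t$, in place of the input.
   Formalization: When Δt > T_tr the feedback uses the new output at negative times, where the new input is not defined; in that case only, the formal statement takes the new input equal to u for t < 0. *)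

(* Defs.v *)
From HB Require Import structures.
From mathcomp Require Import all_boot all_order all_algebra.
From mathcomp Require Import all_classical all_reals all_analysis.
From mathcomp Require Import complex.

Set Implicit Arguments.
Unset Strict Implicit.
Unset Printing Implicit Defensive.

Import Order.TTheory GRing.Theory Num.Theory.
Import numFieldNormedType.Exports.

Local Open Scope classical_set_scope.
Local Open Scope complex_scope.
Local Open Scope ring_scope.

Definition expi {R : realType} (x : R) : R[i] := cos x +i* sin x.

Definition cintegral {R : realType} (D : set R) (f : R -> R[i]) : R[i] :=
  (\int[lebesgue_measure]_(x in D) complex.Re (f x)) +i*
  (\int[lebesgue_measure]_(x in D) complex.Im (f x)).

(* The oriented integral over [a, b], so that it also makes sense for b < a. *)
Definition oriented_integral {R : realType} (a b : R) (f : R -> R) : R :=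
  if a <= b then \int[lebesgue_measure]_(x in `[a, b]) f x
  else - \int[lebesgue_measure]_(x in `[b, a]) f x.

Definition L2norm {R : realType} (a b : R) (f : R -> R[i]) : \bar R :=
  ((\int[lebesgue_measure]_(t in `]a, b[)
      ((Normc.normc (f t)) ^+ 2)%:E) `^ 2^-1)%E.

Definition inL2 {R : realType} (a b : R) (f : R -> R[i]) : Prop :=
  [/\ measurable_fun `]a, b[ (fun t => complex.Re (f t)),
      measurable_fun `]a, b[ (fun t => complex.Im (f t))
    & (L2norm a b f < +oo)%E].

Definition partial_sum {R : realType} (a : int -> R[i]) (N : nat) : R[i] :=
  \sum_(0 <= k < N.*2.+1) a (k%:Z - N%:Z).

(* The sum over all integers, as the limit of the symmetric partial sums, for
   the topology given by the modulus. *)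
Definition series_int {R : realType} (a : int -> R[i]) : R[i] :=
  limn (partial_sum a : nat -> (R[i] : numFieldType)).

(* A basis in the sense of Schauder: every function in L^2(0, T) has one and
   only one expansion, which converges in the L^2 norm. *)
Definition complete_basis_L2 {R : realType} (T : R) (e : int -> R -> R[i]) :
    Prop :=
  (forall n, inL2 0 T (e n)) /\
  (forall f : R -> R[i], inL2 0 T f ->
    exists! a : int -> R[i],
      L2norm 0 T (fun t => f t - partial_sum (fun n => a n * e n t) N)
        @[N --> \oo] --> 0%E).

Definition fourier_coef {R : realType} (W : R -> R) (n : int) : R[i] :=
  ((pi *+ 2)^-1)%:C *
  cintegral `]0, pi *+ 2[ (fun th => (W th)%:C * expi (- (n%:~R * th))).

Definition probability_density {R : realType} (g : R -> R) : Prop :=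
  [/\ measurable_fun setT g,
      forall w, 0 <= g w
    & (\int[lebesgue_measure]_w (g w)%:E = 1)%E].

Definition uniform_symmetric {R : realType} (g : R -> R) : Prop :=
  exists2 gamma : R, 0 < gamma & g = uniform_pdf (- gamma) gamma.

Definition even_unimodal_C2 {R : realType} (g : R -> R) : Prop :=
  [/\ forall w, g (- w) = g w,
      {in `]-oo, 0] &, {homo g : x y / x < y}},
      {in `[0, +oo[ &, {homo g : x y / x < y >-> y < x}},
      [/\ forall x, derivable g x 1,
          forall x, derivable (derive1 g) x 1
        & continuous (derive1n 2 g)]
    & derive1n 2 g 0 < 0].

(* The mean is zero by symmetry. The equation below is imposed without
   integrability of w * g w, and Rintegral is 0 when the positive and the
   negative part have the same infinite integral, so that even heavy-tailed
   densities such as the Lorentzian are allowed. *)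
Definition kuramoto_density {R : realType} (g : R -> R) : Prop :=
  [/\ probability_density g,
      \int[lebesgue_measure]_w (w * g w) = 0
    & uniform_symmetric g \/ even_unimodal_C2 g].

Definition critical_coupling {R : realType} (g : R -> R) : R :=
  2 / (pi * g 0).

(* The integral of f(theta) rho_*(theta, w) over one period of theta, for a
   2 pi-periodic f, where a stands for K r_*. The Dirac mass of a locked
   oscillator sits at arcsin (w / a), a point of the circle R / (2 pi Z). The
   values for |w| = a, where rho_* is not defined, do not matter. *)
Definition drift_density {R : realType} (a th w : R) : R :=
  (pi *+ 2)^-1 * (Num.sqrt (w ^+ 2 - a ^+ 2) / `|w - a * sin th|).

Definition integral_rho_star {R : realType} (a w : R) (f : R -> R[i]) : R[i] :=
  if `|w| < a then f (asin (w / a))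
  else cintegral `[0, pi *+ 2] (fun th => f th * (drift_density a th w)%:C).

(* c_n, where a stands for K r_* *)
Definition kuramoto_constant {R : realType} (g : R -> R) (a : R) (n : int) :
    R[i] :=
  cintegral setT (fun w =>
    integral_rho_star a w (fun th => expi (n%:~R * th)) * (g w)%:C).

(* r_* is the order parameter of the steady state rho_* that it defines. *)
Definition steady_state {R : realType} (g : R -> R) (K r : R) : Prop :=
  0 < r /\
  r%:C = cintegral setT (fun w =>
           integral_rho_star (K * r) w (fun th => expi th) * (g w)%:C).

Definition phase {R : realType} (Omega alpha : R) (u : R -> R) (t : R) : R :=
  Omega * t + alpha * oriented_integral 0 t u.

Definition order_parameter {R : realType} (c : int -> R[i]) (Omega alpha : R)
    (u : R -> R) (n : int) (t : R) : R[i] :=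
  c n * expi (n%:~R * phase Omega alpha u t).

Definition reservoir_output {R : realType} (w c : int -> R[i])
    (Omega alpha : R) (u : R -> R) (t : R) : R[i] :=
  series_int (fun n => w n * order_parameter c Omega alpha u n t).

(* Main.v *)
(* The output is a function of the phase Omega t + alpha int_0^t u alone. The
   choice of Omega makes the phase advance by exactly 2 pi over one period of
   u, so y is T-periodic, and y(t) = u(t + dt), known almost everywhere on
   (0, T), holds almost everywhere on the line. Feeding y back with delay dt
   therefore reproduces u almost everywhere; integrals, hence phases, do not
   see the exceptional null set, and induction over steps of length dt gives
   y_bar = y everywhere. Convergence of the series plays no role. *)

Require Import Defs.
From HB Require Import structures.
From mathcomp Require Import all_boot all_order all_algebra.
From mathcomp Require Import all_classical all_reals all_analysis.
From mathcomp Require Import complex.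
From mathcomp Require Import measurable_realfun ring lra.

Set Implicit Arguments.
Unset Strict Implicit.
Unset Printing Implicit Defensive.

Import Order.TTheory GRing.Theory Num.Theory.
Import numFieldNormedType.Exports.

Local Open Scope classical_set_scope.
Local Open Scope complex_scope.
Local Open Scope ring_scope.

(** * Limits of complex sequences and their measurability *)

Lemma cvg_complex (R : realType) (z : nat -> R[i]) (l : R[i]) :
  (z : nat -> (R[i] : numFieldType)) @ \oo --> (l : (R[i] : numFieldType)) <->
  complex.Re (z n) @[n --> \oo] --> complex.Re l /\
  complex.Im (z n) @[n --> \oo] --> complex.Im l.
Proof.
have Im_le (x : R[i]) : `|complex.Im x|%:C <= `|x|.
  rewrite normc_def lecR -sqrtr_sqr ler_wsqrtr// lerDr; exact: sqr_ge0.
split.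
  move=> /cvgrPdist_lt zl; split; apply/cvgrPdist_lt => e e0.
    have /zl : 0 < e%:C by rewrite ltcR.
    apply: filterS => n; rewrite -ltcR; apply: le_lt_trans.
    by apply: le_trans (normc_ge_Re _); case: (l) (z n) => ? ? [].
  have /zl : 0 < e%:C by rewrite ltcR.
  apply: filterS => n; rewrite -ltcR; apply: le_lt_trans.
  by apply: le_trans (Im_le _); case: (l) (z n) => ? ? [].
move=> [/cvgrPdist_lt rl /cvgrPdist_lt il]; apply/cvgrPdist_lt => e e0.
(* The order of [R[i]] only compares numbers with equal imaginary parts, so the positive radius [e]
   is real. *)
have [e' e'0 ->] : exists2 e' : R, 0 < e' & e = e'%:C.
  by case: e e0 => a b; rewrite ltcE /= => /andP[/eqP -> a0]; exists a.
have h : 0 < e' / 2 by rewrite divr_gt0.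
near=> n.
have hr : `|complex.Re l - complex.Re (z n)| < e' / 2 by near: n; exact: rl.
have hi : `|complex.Im l - complex.Im (z n)| < e' / 2 by near: n; exact: il.
have -> : l - z n = (complex.Re l - complex.Re (z n))%:C +
                    'i * (complex.Im l - complex.Im (z n))%:C.
  by rewrite [LHS]complexE; case: (l) (z n) => ? ? [].
apply: le_lt_trans (ler_normD _ _) _.
have -> : e'%:C = (e' / 2)%:C + (e' / 2)%:C :> R[i].
  by rewrite -rmorphD /= -splitr.
rewrite ltrD//.
  by rewrite normc_def ltcR /= expr0n addr0 sqrtr_sqr.
rewrite normrM [X in X * _](_ : _ = 1) ?mul1r.
  by rewrite normc_def ltcR /= expr0n addr0 sqrtr_sqr.
by rewrite normc_def /= expr0n expr1n add0r sqrtr1.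
Unshelve. all: by end_near. Qed.

(** In the extended reals the lower and upper limits always exist and are measurable in [x];
    convergence to a real number means that they agree and are finite. *)
Lemma measurable_cvgn d (X : measurableType d) (R : realType)
    (f : nat -> X -> R) :
  (forall n, measurable_fun setT (f n)) ->
  measurable [set x | cvgn (f ^~ x)].
Proof.
move=> mf; pose F n x : \bar R := (f n x)%:E.
have mF n : measurable_fun setT (fun x => F n x) by exact/measurable_EFinP.
have mS : measurable_fun setT (fun x => limn_esup (F ^~ x)).
  exact: measurable_fun_limn_esup.
have mI : measurable_fun setT (fun x => limn_einf (F ^~ x)).
  rewrite (_ : (fun x => _) =
               (fun x => - limn_esup ((fun n y => - F n y) ^~ x))%E).
    apply: measurableT_comp => //; apply: measurable_fun_limn_esup => n.
    exact: measurableT_comp.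
  apply/funext => x; rewrite -limn_einfN; congr limn_einf.
  by apply/funext => n; exact/esym/oppeK.
rewrite (_ : mkset _ =
  (setT `&` [set x | limn_einf (F ^~ x) = limn_esup (F ^~ x)]) `&`
  (setT `&` [set x | limn_esup (F ^~ x) \is a fin_num])).
  by apply: measurableI; [exact: measurable_eqe|exact: emeasurable_fin_num].
rewrite !setTI; apply/seteqP; split => x /=.
  move=> /cvg_ex[l fl].
  have Fl : F n x @[n --> \oo] --> l%:E.
    by apply/fine_cvgP; split; [exact: nearW|exact: fl].
  by have [-> ->] := cvg_limn_einf_sup Fl.
move=> [FE Ffin]; apply/cvg_ex; exists (fine (limn_esup (F ^~ x))).
suff : F n x @[n --> \oo] --> (fine (limn_esup (F ^~ x)))%:E.
  by move/fine_cvgP => -[].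
rewrite fineK//.
apply: (@squeeze_cvge _ _ _ _ (einfs (F ^~ x)) _ (esups (F ^~ x))).
- apply: nearW => n; apply/andP; split.
    by apply: ereal_inf_lbound => /=; exists n => //=.
  by apply: ereal_sup_ubound => /=; exists n => //=.
- by rewrite -FE limn_einf_lim; exact: is_cvg_einfs.
- by rewrite limn_esup_lim; exact: is_cvg_esups.
Qed.

(* Where f diverges, l takes the constant junk value of limn. *)
Lemma measurable_lim_complex d (X : measurableType d) (R : realType)
    (f : nat -> X -> R[i]) :
  (forall n, measurable_fun setT (fun x => complex.Re (f n x))) ->
  (forall n, measurable_fun setT (fun x => complex.Im (f n x))) ->
  let l x := limn (f ^~ x : nat -> (R[i] : numFieldType)) in
  measurable_fun setT (fun x => complex.Re (l x)) /\
  measurable_fun setT (fun x => complex.Im (l x)).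
Proof.
move=> mRe mIm l.
pose C := [set x | cvgn (fun n => complex.Re (f n x))] `&`
          [set x | cvgn (fun n => complex.Im (f n x))].
have mC : measurable C by apply: measurableI; exact: measurable_cvgn.
have lC x : C x ->
    complex.Re (f n x) @[n --> \oo] --> complex.Re (l x) /\
    complex.Im (f n x) @[n --> \oo] --> complex.Im (l x).
  move=> -[/= /cvg_ex[a fa] /cvg_ex[b fb]].
  apply/(@cvg_complex R (f ^~ x) (l x)).
  by apply/cvg_ex; exists (a +i* b); apply/(@cvg_complex R (f ^~ x)).
have lNC x : ~ C x -> l x = point.
  move=> nC; apply: dvgP => /cvg_ex[z /(@cvg_complex R (f ^~ x)) [fr fi]].
  apply: nC; split; apply/cvg_ex; first by exists (complex.Re z).
  by exists (complex.Im z).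
(* [p] stands for [complex.Re] or [complex.Im], so that one gluing argument over [C] and its
   complement serves both. *)
suff main (p : R[i] -> R) :
    (forall n, measurable_fun setT (fun x => p (f n x))) ->
    (forall x, C x -> p (f n x) @[n --> \oo] --> p (l x)) ->
    measurable_fun setT (fun x => p (l x)).
  by split; apply: main => // x /lC[].
move=> mp pC; rewrite -(setUv C); apply/measurable_funU => //.
  exact: measurableC.
split.
  apply: (@measurable_fun_cvg _ _ _ _ (fun n x => p (f n x))) => // n.
  exact: measurable_funTS.
apply: (eq_measurable_fun (fun=> p (point : (R[i] : numFieldType)))).
  by move=> x /set_mem/lNC ->.
exact: measurable_cst.
Qed.

(** * Null sets, translations and periodicity *)

(** The pushforward by a translation gives every half-open interval its length, and this
    characterises Lebesgue measure. *)
Lemma lebesgue_measure_translation (R : realType) (a : R) (A : set R) :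
  measurable A ->
  lebesgue_measure ((fun x => x + a) @^-1` A) = lebesgue_measure A.
Proof.
move=> mA; rewrite -[LHS]/(pushforward lebesgue_measure
  ((fun x => x + a) : _ -> measurableTypeR R) A).
apply/esym/lebesgue_measure_unique => //.
  by apply: measurable_funD => //; exact: measurable_id.
move=> mf _ [[b c] _ <-].
rewrite /pushforward.
rewrite [X in _ = lebesgue_measure X](_ : _ = `]b - a, c - a]%classic).
  rewrite !lebesgue_measure_itv/= !lte_fin ltrD2r; case: ifPn => // _.
  by rewrite -!EFinB; congr EFin; ring.
by apply/seteqP; split => x /=; rewrite !in_itv /= ltrBlDr lerBrDr.
Qed.

(** Every countable set is Borel, so the values on [S] are harmless. Equality almost everywhere
    would not do: the Borel sigma-algebra is not complete. *)
Lemma countable_measurable_fun d (X : measurableType d) (R : realType)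
    (D S : set R) (f h : R -> X) :
  measurable D -> countable S -> measurable_fun D h ->
  (forall x, D x -> ~ S x -> f x = h x) -> measurable_fun D f.
Proof.
move=> mD cS mh fh _ Y mY.
have mc (A : set R) : countable A -> measurable A.
  by apply: countable_measurable => t; exact: measurable_set1.
rewrite (_ : _ `&` _ = (D `&` S `&` f @^-1` Y) `|` (D `&` h @^-1` Y) `\` S).
  apply: measurableU.
    by apply: mc; apply: sub_countable cS; apply: subset_card_le => x [[]].
  by apply: measurableD; [exact: mh|exact: mc].
apply/seteqP; split => x.
  move=> [Dx fx]; have [Sx|Sx] := pselect (S x); [by left|right].
  by split=> //; split=> //=; rewrite -fh.
by move=> [[[]//]|[[Dx hx] Sx]]; split=> //=; rewrite fh.
Qed.

Lemma negligible_translation (R : realType) (a : R) (A : set R) :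
  lebesgue_measure.-negligible A ->
  lebesgue_measure.-negligible ((fun x => x + a) @^-1` A).
Proof.
move=> [N [mN N0 AN]]; exists ((fun x => x + a) @^-1` N); split.
- rewrite -[X in measurable X]setTI; exact: measurable_funD.
- by rewrite /= lebesgue_measure_translation.
- by move=> x /AN.
Qed.

(** Subtracting [floor (t / T)] periods moves each point of [P] into [[0, T[], so countably many
    translates of a null set cover [P]. The endpoint [0], missing from the open interval, is added
    as a null set. *)
Lemma negligible_periodic (R : realType) (T : R) (P : set R) : 0 < T ->
  (forall t, P (t + T) <-> P t) ->
  lebesgue_measure.-negligible (P `&` `]0, T[) ->
  lebesgue_measure.-negligible P.
Proof.
move=> T0 PT neg.
have PTn (n : nat) t : P (t + n%:R * T) <-> P t.
  elim: n t => [|n IH] t; first by rewrite mul0r addr0.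
  by rewrite -natr1 mulrDl mul1r addrA PT.
pose B := (P `&` `]0, T[) `|` [set 0].
have nB : lebesgue_measure.-negligible B.
  apply: negligibleU => //; exists [set 0]; split => //.
  exact: lebesgue_measure_set1.
pose C (n : nat) := (fun x => x + n%:R * T) @^-1` B `|`
  (fun x => x + - (n%:R * T)) @^-1` B.
have : lebesgue_measure.-negligible (\bigcup_n C n).
  apply: negligible_bigcup => n.
  by apply: negligibleU; exact: negligible_translation.
apply: negligibleS.
move=> t Pt.
have /andP[] := floor_itv (t / T); set z := Num.floor (t / T).
rewrite ler_pdivlMr// ltr_pdivrMr// => z1 z2.
have zB : P (t - z%:~R * T) -> B (t - z%:~R * T).
  move=> Pz; have [e|e] := eqVneq (t - z%:~R * T) 0; [by right|left].
  split=> //=; rewrite in_itv/= lt_neqAle eq_sym e /= subr_ge0 z1/=.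
  by rewrite ltrBlDl -[X in _ < _ + X]mul1r -mulrDl -(intrD _ z 1).
case: z z1 z2 zB => n _ _ zB.
  exists n => //; right; apply: zB.
  by rewrite -(PTn n) -pmulrn subrK.
(* A negative floor [Negz n] is [- n.+1], hence the index [n.+1] and the preimage under the forward
   shift. *)
exists n.+1 => //; left.
by move: zB; rewrite NegzE mulrNz mulNr opprK -pmulrn; apply; apply/PTn.
Qed.

(** * Calculus of the oriented integral and regularity of the output *)

Lemma is_derive_oriented_integral (R : realType) (f : R -> R) :
  continuous f ->
  forall x : R, is_derive x 1 (fun t => oriented_integral 0 t f) (f x).
Proof.
move=> cf x.
(* Both [0] and [x] lie strictly to the right of [a], so one primitive [F] based at [a] serves both
   orientations: near [x] the oriented integral is [F t - F 0]. *)
pose a := Num.min 0 x - 1; pose b := Num.max 0 x + 1.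
have a0 : a < 0 by rewrite ltrBlDr gt_min add0r ltr01.
have ax : a < x by rewrite ltrBlDr gt_min ltrDl ltr01 orbT.
have xb : x < b.
  by rewrite (le_lt_trans (y := Num.max 0 x)) ?ltrDl// le_max lexx orbT.
have intf c d : lebesgue_measure.-integrable `[c, d] (EFin \o f).
  apply: continuous_compact_integrable; first exact: segment_compact.
  exact: continuous_subspaceT.
pose F t := \int[lebesgue_measure]_(s in `[a, t]) f s.
have [dF dFE] : derivable F x 1 /\ derive1 F x = f x.
  by apply: (@continuous_FTC1_closed _ _ _ _ b) => //; exact: cf.
have FB c d : a <= c -> c <= d ->
    \int[lebesgue_measure]_(s in `[c, d]) f s = F d - F c.
  move=> ac cd; rewrite /F Rintegral_itvB ?bnd_simp//.
  rewrite Rintegral_itv_obnd_cbnd//.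
  apply: integrableS (intf c d) => //; exact: subset_itv_oc_cc.
apply: (@near_eq_is_derive _ _ _ (fun t => F t - F 0)).
  near=> t; rewrite /oriented_integral; case: ifPn => [t0|].
    by rewrite FB// ltW.
  rewrite -ltNge => t0; rewrite FB ?opprB//; last exact: ltW.
  by apply: ltW; near: t; exact: lt_nbhsr.
rewrite -[X in is_derive _ _ _ X]subr0; apply: is_deriveB.
by apply: DeriveDef => //; rewrite -derive1E.
Unshelve. all: by end_near. Qed.

(** With [G] the primitive vanishing at [0], [G (s + T) - G s] has derivative [f (s + T) - f s = 0],
    hence keeps its value [G T] at [s = 0]. *)
Lemma oriented_integral_periodic (R : realType) (f : R -> R) (T : R) :
  continuous f -> periodic f T -> forall t,
  oriented_integral 0 (t + T) f =
  oriented_integral 0 t f + oriented_integral 0 T f.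
Proof.
move=> cf fT t; pose G s := oriented_integral 0 s f.
have G0 : G 0 = 0 by rewrite /G /oriented_integral lexx set_itv1 Rintegral_set1.
pose H s := G (s + T) - G s.
suff : H t = H 0.
  by rewrite /H add0r G0 subr0 => /eqP; rewrite subr_eq [G T + _]addrC => /eqP.
apply: is_derive_0_is_cst => x.
rewrite -[X in is_derive _ _ _ X](subrr (f x)); apply: is_deriveB; last first.
  exact: is_derive_oriented_integral.
rewrite -[X in is_derive _ _ _ X]mulr1.
apply: (@is_derive1_comp _ G (fun s => s + T)).
  by rewrite -fT; exact: is_derive_oriented_integral.
by rewrite -[X in is_derive _ _ _ X]addr0; exact: is_deriveD.
Qed.

Lemma expi_periodic (R : realType) (n : int) (x : R) :
  expi (n%:~R * (x + pi *+ 2)) = expi (n%:~R * x).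
Proof.
have main (m : nat) z : expi (z + pi *+ 2 *+ m) = expi z :> R[i].
  by rewrite /expi (periodicn (@cosD2pi R)) (periodicn (@sinD2pi R)).
case: n => m.
  by rewrite -pmulrn mulrDr [_ * (pi *+ 2)]mulr_natl main.
rewrite NegzE mulrNz -pmulrn mulrDr.
rewrite [_ * (pi *+ 2)]mulNr [_ * (pi *+ 2)]mulr_natl.
by rewrite -[LHS](main m.+1) subrK.
Qed.

Lemma continuous_phase (R : realType) (Omega alpha : R) (u : R -> R) :
  continuous u -> continuous (phase Omega alpha u).
Proof.
move=> cu x; apply: continuousD.
  by apply: continuousM; [exact: cst_continuous|exact: id].
apply: continuousM; first exact: cst_continuous.
apply: differentiable_continuous; apply/derivable1_diffP.
by have [] := is_derive_oriented_integral cu x.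
Qed.

(** The partial sums are continuous functions of the phase, and [measurable_lim_complex] passes to
    the limit. This lets a vanishing norm be read as equality almost everywhere. *)
Lemma measurable_reservoir_output (R : realType) (w c : int -> R[i])
    (Omega alpha : R) (u : R -> R) : continuous u ->
  let y := reservoir_output w c Omega alpha u in
  measurable_fun setT (fun t => complex.Re (y t)) /\
  measurable_fun setT (fun t => complex.Im (y t)).
Proof.
move=> cu; rewrite /reservoir_output /series_int.
set a := fun t n => w n * order_parameter c Omega alpha u n t.
have ctrig (f : R -> R) (n : int) : continuous f ->
    measurable_fun setT (fun t => f (n%:~R * phase Omega alpha u t)).
  move=> cf; apply: continuous_measurable_fun => x.
  apply: (@continuous_comp _ _ _ (fun t => n%:~R * phase Omega alpha u t) f).
    by apply: continuousM; [exact: cst_continuous|exact: continuous_phase].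
  exact: cf.
have mcos n := ctrig _ n (@continuous_cos R).
have msin n := ctrig _ n (@continuous_sin R).
have aE t n : a t n = (w n * c n) * expi (n%:~R * phase Omega alpha u t).
  by rewrite /a /order_parameter mulrA.
have mRe n : measurable_fun setT (fun t => complex.Re (a t n)).
  under eq_fun do rewrite aE.
  case: (w n * c n) => p q /=.
  by apply: measurable_funB; apply: measurable_funM.
have mIm n : measurable_fun setT (fun t => complex.Im (a t n)).
  under eq_fun do rewrite aE.
  case: (w n * c n) => p q /=.
  by apply: measurable_funD; apply: measurable_funM.
apply: (@measurable_lim_complex _ _ _ (fun N t => partial_sum (a t) N)) => N.
  rewrite /partial_sum.
  (* [Rcomplex R] is [R[i]] seen as a real vector space, on which [complex.Re] is additive and so
     commutes with the sum. *)
  under eq_fun do rewrite (raddf_sum (@complex.Re R : Rcomplex R -> R)).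
  by apply: measurable_sum => k; exact: mRe.
rewrite /partial_sum.
under eq_fun do rewrite (raddf_sum (@complex.Im R : Rcomplex R -> R)).
by apply: measurable_sum => k; exact: mIm.
Qed.

(** * Integrals and norms up to null sets *)

(** Measurability of [f], not given in advance, is inherited from the intermediate [h] on the range
    of integration. Only that range is compared, which is what an induction over time can supply. *)
Lemma eq_oriented_integral_ae (R : realType) (S : set R) (f h g : R -> R)
    (t : R) :
  countable S -> measurable_fun setT h -> measurable_fun setT g ->
  lebesgue_measure.-negligible [set s | h s <> g s] ->
  (forall s, 0 <= s <= t \/ t <= s <= 0 -> ~ S s -> f s = h s) ->
  oriented_integral 0 t f = oriented_integral 0 t g.
Proof.
move=> cS mh mg hg fh.
have eqI (D : set R) : measurable D -> (forall s, D s -> ~ S s -> f s = h s) ->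
    \int[lebesgue_measure]_(s in D) f s = \int[lebesgue_measure]_(s in D) g s.
  move=> mD fhD; congr fine; apply: ae_eq_integral => //.
  - apply/measurable_EFinP; apply: (countable_measurable_fun mD cS _ fhD).
    exact: measurable_funTS.
  - by apply/measurable_EFinP; exact: measurable_funTS.
  have nS : lebesgue_measure.-negligible S.
    exists S; split => //; last exact: countable_lebesgue_measure0.
    by apply: countable_measurable cS => s; exact: measurable_set1.
  apply: negligibleS (negligibleU nS hg) => s /= /not_implyP[Ds fg].
  have [Ss|Ss] := pselect (S s); [by left|right => hgs].
  by apply: fg; rewrite fhD// hgs.
rewrite /oriented_integral; case: ifPn => t0.
  by apply: eqI => // s /=; rewrite in_itv /= => ? ?; apply: fh => //; left.
congr -%R; apply: eqI => // s /=; rewrite in_itv/= => ? ?.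
by apply: fh => //; right.
Qed.

Lemma L2norm_eq0 (R : realType) (a b : R) (f : R -> R[i]) :
  measurable_fun setT (fun t => complex.Re (f t)) ->
  measurable_fun setT (fun t => complex.Im (f t)) ->
  L2norm a b f = 0%E <->
  lebesgue_measure.-negligible ([set t | f t <> 0] `&` `]a, b[).
Proof.
move=> mRe mIm.
pose F t : \bar R := ((Normc.normc (f t)) ^+ 2)%:E.
have F0 t : (0 <= F t)%E by rewrite lee_fin sqr_ge0.
have normE t :
    Normc.normc (f t) ^+ 2 = complex.Re (f t) ^+ 2 + complex.Im (f t) ^+ 2.
  by case: (f t) => p q; rewrite /= sqr_sqrtr// addr_ge0// sqr_ge0.
have mF : measurable_fun `]a, b[ F.
  apply: measurable_funTS; apply/measurable_EFinP.
  under eq_fun do rewrite normE.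
  by apply: measurable_funD; exact: measurable_funX.
have mab := measurable_itv (Interval (BRight a) (BLeft b)).
have := ae_eq_integral_abs lebesgue_measure mab mF.
under eq_integral do rewrite gee0_abs//.
have -> : ae_eq lebesgue_measure `]a, b[%classic F (cst 0%E) <->
    lebesgue_measure.-negligible ([set t | f t <> 0] `&` `]a, b[).
  rewrite /ae_eq /almost_everywhere/=.
  rewrite [X in _.-negligible X <-> _](_ : _ =
    [set t | f t <> 0] `&` `]a, b[) //.
  apply/seteqP; split => t /=.
    move=> /not_implyP[tab Ft]; split => // ft.
    by apply: Ft; rewrite /F ft Normc.normc0 expr0n.
  move=> [ft tab]; apply/not_implyP; split => // -[] /eqP.
  by rewrite sqrf_eq0 => /eqP/Normc.eq0_normc.
move=> <-; rewrite /L2norm; split => [/poweR_eq0_eq0 -> //|->].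
  by apply: integral_ge0 => t _; exact: F0.
by rewrite poweR0r // invr_neq0.
Qed.

Theorem theorem6p2 (R : realType)
  (g : R -> R) (g_density : kuramoto_density g)
  (K : R) (K_supercritical : critical_coupling g < K)
  (r : R) (r_steady : steady_state g K r)
  (c : int -> R[i]) (c_def : forall n, c n = kuramoto_constant g (K * r) n)
  (T : R) (T_gt0 : 0 < T)
  (u : R -> R) (u_cont : continuous u)
  (u_bounded : [bounded u t | t in [set: R]])
  (u_periodic : periodic u T)
  (dt : R) (dt_gt0 : 0 < dt)
  (y_tar : R -> R) (y_tar_def : forall t, y_tar t = u (t + dt))
  (alpha Omega : R)
  (Omega_def : Omega = T^-1 * (pi *+ 2 - alpha * oriented_integral 0 T u))
  (Omega_gt0 : 0 < Omega)
  (c_neq0 : forall n, c n != 0)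
  (r_basis : complete_basis_L2 T (order_parameter c Omega alpha u))
  (W_out : R -> R) (W_out_L2 : inL2 0 (pi *+ 2) (fun th => (W_out th)%:C))
  (w : int -> R[i]) (w_def : forall n, w n = fourier_coef W_out n)
  (y : R -> R[i])
  (y_def : forall t, y t = reservoir_output w c Omega alpha u t)
  (y_trained : L2norm 0 T (fun t => y t - (y_tar t)%:C) = 0%E)
  (T_tr : R) (T_tr_ge : T <= T_tr)
  (u_bar : R -> R) (y_bar : R -> R[i])
  (y_bar_def : forall t, y_bar t = reservoir_output w c Omega alpha u_bar t)
  (u_bar_training : forall t, 0 < t < T_tr -> u_bar t = u t)
  (u_bar_autonomous : forall t, T_tr < t -> (u_bar t)%:C = y_bar (t - dt))
  (* If dt > T_tr, the feedback reaches back to times before 0, where the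
     input is u, too. *)
  (u_bar_past : T_tr < dt -> forall t, t < 0 -> u_bar t = u t) :
  forall k : nat,
    (forall t, 0 < t < k%:R * T -> y t = y_bar t) /\
    L2norm 0 (k%:R * T) (fun t => y_bar t - (y_tar t)%:C) = 0%E.
Proof.
have phaseT t : phase Omega alpha u (t + T) = phase Omega alpha u t + pi *+ 2.
  rewrite /phase oriented_integral_periodic// !mulrDr addrACA; congr (_ + _).
  by rewrite Omega_def mulrAC mulVf ?gt_eqF// mul1r subrK.
have yT t : y (t + T) = y t.
  rewrite !y_def /reservoir_output; congr series_int; apply/funext => n.
  by rewrite /order_parameter phaseT expi_periodic.
have mu : measurable_fun setT u by exact: continuous_measurable_fun.
have shiftm (a : R) : measurable_fun setT (fun t : R => t + a).
  exact: measurable_funD.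
have [mRe mIm] : measurable_fun setT (fun t => complex.Re (y t)) /\
                 measurable_fun setT (fun t => complex.Im (y t)).
  have -> : y = reservoir_output w c Omega alpha u by apply/funext.
  exact: measurable_reservoir_output.
pose err t := y t - (y_tar t)%:C.
have mu' : measurable_fun setT y_tar.
  rewrite (_ : y_tar = (fun t => u (t + dt))); last exact/funext.
  exact: (measurableT_comp mu (shiftm dt)).
have err_neg a b : L2norm a b err = 0%E <->
    lebesgue_measure.-negligible ([set t | err t <> 0] `&` `]a, b[).
  apply: L2norm_eq0.
    rewrite (_ : (fun t => _) = (fun t => complex.Re (y t) - y_tar t)).
      exact: measurable_funB.
    by apply/funext => t; rewrite /err; case: (y t).
  rewrite (_ : (fun t => _) = (fun t => complex.Im (y t))) //.
  by apply/funext => t; rewrite /err; case: (y t) => p q /=;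
    rewrite oppr0 addr0.
have err_ae : lebesgue_measure.-negligible [set t | err t <> 0].
  apply: (negligible_periodic T_gt0); last exact/err_neg.
  by move=> t /=; rewrite /err yT !y_tar_def addrAC u_periodic.
(* [h] is the fed-back input with [y] in place of [y_bar]: it is measurable and does not involve the
   unknown [u_bar]. *)
pose h s := if s < T_tr then u s else complex.Re (y (s - dt)).
have mh : measurable_fun setT h.
  apply: measurable_fun_ifT => //.
    by apply: measurable_fun_ltr => //; exact: measurable_id.
  exact: (measurableT_comp mRe (shiftm (- dt))).
(* From [T_tr] on, [u s] is [y_tar (s - dt)], so [h] can differ from [u] only where [err (s - dt)]
   is nonzero. *)
have hu : lebesgue_measure.-negligible [set s | h s <> u s].
  apply: negligibleS (negligible_translation (- dt) err_ae) => s /=.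
  rewrite /h; case: ifPn => // _ yu /eqP; rewrite subr_eq0 => /eqP ys.
  by apply: yu; rewrite ys /= y_tar_def subrK.
(* At the switching times [0] and [T_tr] the definition of [u_bar] prescribes no value. *)
have cS : countable [set 0; T_tr].
  by apply: finite_set_countable; exact: finite_set2.
have yyE t : oriented_integral 0 t u_bar = oriented_integral 0 t u ->
    y_bar t = y t.
  move=> e; rewrite y_bar_def y_def /reservoir_output; congr series_int.
  by apply/funext => n; rewrite /order_parameter /phase e.
have T_tr_gt0 : 0 < T_tr by exact: lt_le_trans T_tr_ge.
have u_bar_before s t : 0 <= s <= t \/ t <= s <= 0 -> 0 <= t \/ T_tr < dt ->
    s != 0 -> s < T_tr -> u_bar s = u s.
  move=> st t0 s0 s_early; have [s_lt0|s_gt0|sE] := ltgtP s 0;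
    last by rewrite sE eqxx in s0.
    by apply: u_bar_past => //; case: t0 => // t0; lra.
  by apply: u_bar_training; rewrite s_gt0.
have main (j : nat) t : t <= T_tr + j%:R * dt -> 0 <= t \/ T_tr < dt ->
    y_bar t = y t.
  elim: j t => [|j IH] t tj t0; apply: yyE;
    apply: (@eq_oriented_integral_ae _ [set 0; T_tr] _ h) => // s st;
    move=> /not_orP[/eqP s0 /eqP sT]; rewrite /h; case: ltP => sT_tr.
  - exact: u_bar_before st t0 s0 sT_tr.
  - by lra.
  - exact: u_bar_before st t0 s0 sT_tr.
  have {}sT_tr : T_tr < s by rewrite lt_neqAle eq_sym sT.
  suff <- : y_bar (s - dt) = y (s - dt) by rewrite -u_bar_autonomous.
  (* If [dt <= T_tr], then [s - dt > T_tr - dt >= 0]; otherwise the second alternative holds. *)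
  apply: IH; last by case: (ltP T_tr dt) => ?; [right|left; lra].
  by move: tj; rewrite -natr1 mulrDl mul1r; lra.
move=> k; have yk t : 0 < t -> y_bar t = y t.
  (* More than [t / dt] delays are enough to reach [t]. *)
  move=> t0; apply: (main (Num.truncn (t / dt)).+1); last by left; exact: ltW.
  rewrite -[leLHS]add0r lerD ?(ltW T_tr_gt0)//.
  by rewrite -ler_pdivrMr//; exact/ltW/truncnS_gt.
split=> [t /andP[t0 _]|]; first by rewrite yk.
(* The error of [y] has norm zero on any interval by [err_ae]; that of [y_bar] is the same function
   at positive times. *)
have <- : L2norm 0 (k%:R * T) err = 0%E.
  apply/err_neg; apply: negligibleS err_ae; exact: subIsetl.
congr poweR; apply: eq_integral => t; rewrite inE /= in_itv /= => /andP[t0 _].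
by rewrite yk.
Qed.
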